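(* Let $\sim$ be an equivalence relation on a non-empty set $X$, let $\mathbb{X}=\langle X,\sim\rangle$, and let $\{X_i : i\in I\}$ be the corresponding partition of $X$ into equivalence classes. Then $\mathbb{X}$ is reversible if and only if $\langle |X_i| : i\in I\rangle$ is a reversible sequence of cardinals. The same equivalence holds for graphs of the form $\mathbb{X}=\bigcup_{i\in I}\mathbb{X}_i$ where $\mathbb{X}_i$, $i\in I$, are pairwise disjoint non-empty complete graphs, and for posets of the form $\mathbb{X}=\bigcup_{i\in I}\mathbb{X}_i$ where $\mathbb{X}_i$, $i\in I$, are pairwise disjoint posets each isomorphic to a non-zero ordinal $\leq\omega$ (with its natural order); in each case $X_i$ denotes the domain of $\mathbb{X}_i$.
   Context: A relational structure $\mathbb{X}=\langle X,\rho\rangle$ is reversible iff every bijective homomorphism $f:\mathbb{X}\to\mathbb{X}$ (i.e. bijection $f$ with $\langle x,y\rangle\in\rho\Rightarrow\langle f(x),f(y)\rangle\in\rho$) is an automorphism. The disjoint union $\bigcup_{i\in I}\mathbb{X}_i$ of structures $\langle X_i,\rho_i\rangle$ with pairwise disjoint domains is $\langle\bigcup_i X_i,\bigcup_i\rho_i\rangle$. A sequence of non-zero cardinals $\langle\kappa_i:i\in I\rangle$ is reversible iff there is no non-injective surjection $f:I\to I$ such that $\kappa_j=\sum_{i\in f^{-1}[\{j\}]}\kappa_i$ for all $j\in I$. *)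

(* Defs.v *)
From mathcomp Require Import all_boot.
From mathcomp Require Import boolp classical_sets functions cardinality.

Set Implicit Arguments.
Unset Strict Implicit.
Unset Printing Implicit Defensive.

Local Open Scope classical_set_scope.
Local Open Scope card_scope.

(* A structure <X, rho> whose domain X is a subset of an ambient type T, so
   that "disjoint domains" and unions of domains make literal sense.  Maps
   between structures are total functions on the ambient types, of which only
   the values on the domain matter. *)
Record relstruct (T : Type) := RelStruct {
  dom : set T;
  rel_of : set (T * T);
  rel_of_sub : rel_of `<=` dom `*` dom
}.

Definition homomorphism T U (X : relstruct T) (Y : relstruct U) (f : T -> U) :=
  set_fun (dom X) (dom Y) f /\
  (forall x y, dom X x -> dom X y -> rel_of X (x, y) -> rel_of Y (f x, f y)).

Definition isomorphism T U (X : relstruct T) (Y : relstruct U) (f : T -> U) :=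
  set_bij (dom X) (dom Y) f /\
  (forall x y, dom X x -> dom X y -> (rel_of X (x, y) <-> rel_of Y (f x, f y))).

Definition automorphism T (X : relstruct T) (f : T -> T) := isomorphism X X f.

Definition reversible T (X : relstruct T) :=
  forall f : T -> T,
    set_bij (dom X) (dom X) f -> homomorphism X X f -> automorphism X f.

Lemma union_rel_sub T I (X : I -> relstruct T) :
  \bigcup_i rel_of (X i) `<=` (\bigcup_i dom (X i)) `*` (\bigcup_i dom (X i)).
Proof. by move=> p [i _ /rel_of_sub [? ?]]; split; exists i. Qed.

Definition union_struct T I (X : I -> relstruct T) : relstruct T :=
  RelStruct (@union_rel_sub T I X).

Definition pairwise_disjoint T I (X : I -> relstruct T) :=
  trivIset setT (fun i => dom (X i)).

Definition equivalence_struct T (X : relstruct T) :=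
  [/\ forall x, dom X x -> rel_of X (x, x),
      forall x y, rel_of X (x, y) -> rel_of X (y, x) &
      forall x y z, rel_of X (x, y) -> rel_of X (y, z) -> rel_of X (x, z)].

Definition equiv_class T (X : relstruct T) (x : T) : set T :=
  [set y | rel_of X (x, y)].

(* F enumerates the set of equivalence classes of X without repetition. *)
Definition indexes_classes T I (X : relstruct T) (F : I -> set T) :=
  injective F /\ range F = [set equiv_class X x | x in dom X].

Definition complete_graph T (X : relstruct T) :=
  forall x y, dom X x -> dom X y -> (rel_of X (x, y) <-> x <> y).

(* The ordinals <= omega as von Neumann ordinals: [Some n] is {0, ..., n-1}
   and [None] is omega. *)
Definition ordinal_dom (o : option nat) : set nat :=
  if o is Some n then `I_n else setT.

Definition ordinal_rel (o : option nat) : set (nat * nat) :=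
  (ordinal_dom o `*` ordinal_dom o) `&` [set p | p.1 <= p.2].

Lemma ordinal_rel_sub o : ordinal_rel o `<=` ordinal_dom o `*` ordinal_dom o.
Proof. by move=> p []. Qed.

Definition ordinal_struct (o : option nat) : relstruct nat :=
  RelStruct (@ordinal_rel_sub o).

Definition iso_nonzero_ordinal_le_omega T (X : relstruct T) :=
  exists o : option nat,
    o <> Some 0 /\ exists f : T -> nat, isomorphism X (ordinal_struct o) f.

(* The sequence <kappa_i : i in I> of cardinals is given by representatives,
   kappa_i = |K i|, assumed non-empty where this is used; cardinals are equal
   when the representatives are equipotent, and the sum of kappa_i over a set J
   of indices is the cardinal of the tagged union {(i, x) | i in J, x in K i}. *)
Definition card_sum_repr U I (J : set I) (K : I -> set U) : set (I * U) :=
  J `*`` K.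

Definition reversible_seq U I (K : I -> set U) :=
  ~ exists f : I -> I,
      [/\ set_surj setT setT f, ~ injective f &
          forall j, K j #= card_sum_repr (f @^-1` [set j]) K].

(* Main.v *)
Require Import Defs.
From HB Require Import structures.
From mathcomp Require Import all_boot.
From mathcomp Require Import boolp classical_sets functions cardinality.

Local Open Scope classical_set_scope.

(** In all three cases two distinct points of the same component are related
    one way or the other, and points of distinct components are unrelated.
    Hence a homomorphism [f] maps components into components; if [f] is a
    bijection, the induced map [g] on indices is a surjection whose fibres
    realize the cardinal sums, and [f] is an automorphism as soon as [g] is
    injective.  Conversely, from a non-injective [g] with
    [|X_j| = \sum_(g i = j) |X_i|] one glues bijections between the union of
    the components over the fibre of [j] and [X_j] into a bijective
    homomorphism that relates points of different components.  For chains of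
    type [<= omega] the gluing bijections have to be increasing on each
    component: embed the fibre injectively into [nat] so that each chain is
    increasing, and collapse the image onto an initial segment. *)

(** * Equipotence and initial segments of [nat] *)

(** The map must be defined on all of [U]; a point of [B] supplies its value outside [A]. *)
Lemma card_eq_set_bijP {U V} {A : set U} {B : set V} :
  B !=set0 -> (A #= B)%card <-> exists f : U -> V, set_bij A B f.
Proof.
move=> [b _].
pose V' : pointedType :=
  HB.pack V (gen_eqMixin V) (gen_choiceMixin V) (isPointed.Build V b).
by split=> /(@card_set_bijP U V' A B).
Qed.

(** The initial segments of [nat] are exactly the ordinals up to omega, and distinct ones have
    distinct cardinalities. *)
Lemma down_closed_card_eq (A : set nat) (o : option nat) :
  (forall m n, A n -> m < n -> A m) -> (A #= ordinal_dom o)%card ->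
  A = ordinal_dom o.
Proof.
move=> dcA.
have [AT|/existsNP[n0 An0]] := pselect (forall n, A n).
  have -> : A = setT by rewrite -subTset => n _; exact: AT.
  case: o => [n|] //= An.
  by case: infinite_nat; exists n.
(* The least number outside [A] is the length of the segment. *)
have ex : exists n, `[< ~ A n >] by exists n0; apply/asboolP.
case: (ex_minnP ex) => m /asboolP Am minm.
have -> : A = `I_m.
  apply/seteqP; split=> k /=.
    move=> Ak; rewrite ltnNge; apply/negP.
    rewrite leq_eqVlt => /orP[/eqP mk|mk].
      by apply: Am; rewrite mk.
    by apply: Am; apply: dcA mk.
  move=> km; apply: contrapT => nAk.
  by have /minm : `[< ~ A k >] by [exact/asboolP]; rewrite leqNgt km.
case: o => [n /card_eq_II -> //|/= mT].
by case: infinite_nat; exists m; rewrite card_eq_sym.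
Qed.

(** * Order collapse of a set of natural numbers *)

Section Rank.
Variable S : set nat.

(** Restricted to [S], this is the order isomorphism onto an initial segment of [nat]. *)
Definition rank n := \sum_(m < n) (`[< S m >] : nat).

Lemma rankS n : rank n.+1 = rank n + `[< S n >].
Proof. by rewrite /rank big_ord_recr. Qed.

Lemma rank_le {m n} : m <= n -> rank m <= rank n.
Proof.
move=> /subnK <-; elim: (n - m) => // k IH.
by rewrite addSn rankS (leq_trans IH)// leq_addr.
Qed.

Lemma rank_lt {m n} : S m -> m < n -> rank m < rank n.
Proof.
move=> Sm mn; apply: leq_trans (rank_le mn).
by rewrite rankS asboolT// addn1.
Qed.

Lemma rank_inj {m n} : S m -> S n -> rank m = rank n -> m = n.
Proof.
move=> Sm Sn e; case: (ltngtP m n) => // /rank_lt.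
  by move=> /(_ Sm); rewrite e ltnn.
by move=> /(_ Sn); rewrite e ltnn.
Qed.

(** The rank starts at 0 and grows by at most one at each step, so it skips no value. *)
Lemma rank_onto {n k} : k < rank n -> exists2 m, S m & rank m = k.
Proof.
elim: n => [|n IH]; first by rewrite /rank big_ord0.
rewrite rankS; have [Sn|nSn] := pselect (S n).
  rewrite asboolT// addn1 ltnS leq_eqVlt => /orP[/eqP ->|]; last exact: IH.
  by exists n.
by rewrite asboolF// addn0; exact: IH.
Qed.

End Rank.

(** Ranking the points of [E] inside the image of [h] gives a down-closed set equipotent to [E], so
    cardinality alone identifies it with the given ordinal. *)
Lemma collapse_to_ordinal {U} {E : set U} {o : option nat} {h : U -> nat} :
  set_inj E h -> (E #= ordinal_dom o)%card ->
  exists k : U -> nat, set_bij E (ordinal_dom o) k /\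
    (forall u v, E u -> E v -> h u <= h v -> k u <= k v).
Proof.
move=> hinj Eo; pose S := h @` E; pose k u := rank S (h u).
have kinj : set_inj E k.
  move=> u v Eu Ev kuv; apply: (hinj) => //.
  by apply: (rank_inj S) => //; [exists u|exists v]; rewrite // -in_setE.
have imE : k @` E = ordinal_dom o.
  apply: down_closed_card_eq.
    move=> m n [u Eu <-] /rank_onto[_ [v Ev <-] <-].
    by exists v.
  exact: card_eq_trans (inj_card_eq kinj) Eo.
exists k; split; last by move=> u v _ _; exact: rank_le.
split=> //; last by rewrite -imE.
by move=> u Eu; rewrite -imE; exists u.
Qed.

(* [2 ^ c * (2 * r + 1)] is an injective pairing that is increasing in [r]. *)
Lemma odd_pow2_inj {c c' r r'} :
  2 ^ c * r.*2.+1 = 2 ^ c' * r'.*2.+1 -> c = c' /\ r = r'.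
Proof.
move=> e.
have lg d s : logn 2 (2 ^ d * s.*2.+1) = d.
  rewrite lognM// ?expn_gt0// pfactorK// lognE /=.
  by rewrite dvdn2 /= odd_double addn0.
have ec : c = c' by rewrite -(lg c r) e lg.
split=> //; move: e; rewrite ec => /eqP.
by rewrite eqn_pmul2l ?expn_gt0// eqSS => /eqP /double_inj.
Qed.

(** * The criterion for structures split into components *)

Section Components.
Variables (T I : Type) (X : relstruct T) (D : I -> set T).

Hypothesis domE : dom X = \bigcup_i D i.
Hypothesis Ddisj : trivIset setT D.
Hypothesis Dn0 : forall i, D i !=set0.
Hypothesis rel_comp :
  forall x y, rel_of X (x, y) -> exists i, D i x /\ D i y.
Hypothesis comp_rel :
  forall i x y, D i x -> D i y -> x <> y -> rel_of X (x, y) \/ rel_of X (y, x).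
Hypothesis hom_reflects : forall f i x y,
  set_bij (dom X) (dom X) f -> homomorphism X X f -> D i x -> D i y ->
  rel_of X (f x, f y) -> rel_of X (x, y).
(** For equivalence classes and complete graphs any bijection serves; chains require one that is
    increasing on each summand. *)
Hypothesis gluing : forall (J : set I) j,
  (D j #= card_sum_repr J D)%card ->
  exists phi : I * T -> T, set_bij (J `*`` D) (D j) phi /\
    (forall i x y, J i -> D i x -> D i y -> rel_of X (x, y) ->
       rel_of X (phi (i, x), phi (i, y))).

Lemma comp_uniq {i j x} : D i x -> D j x -> i = j.
Proof. by move=> Dix Djx; apply: Ddisj => //; exists x. Qed.

Lemma comp_dom {i x} : D i x -> dom X x.
Proof. by move=> Dix; rewrite domE; exists i. Qed.

Lemma dom_comp {x} : dom X x -> exists i, D i x.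
Proof. by rewrite domE => -[i _ Dix]; exists i. Qed.

Lemma reversible_of_seq : reversible_seq D -> reversible X.
Proof.
move=> revD f fbij fhom; have [ffun finj fsurj] := fbij.
have finj' x y : dom X x -> dom X y -> f x = f y -> x = y.
  by move=> dx dy; apply: finj; rewrite inE.
(* Every point of [D i] is compared with the base point [x0]: being related one way or the other,
   their images share a component. *)
have exg i : exists j, forall x, D i x -> D j (f x).
  have [x0 Dx0] := Dn0 i.
  have [j Dj0] := dom_comp (ffun _ (comp_dom Dx0)).
  exists j => x Dx; have [->//|xx0] := pselect (x = x0).
  have [r|r] := comp_rel _ _ _ Dx Dx0 xx0; have [d d'] := rel_of_sub r;
    have [j' [Dj1 Dj2]] := rel_comp _ _ (fhom.2 _ _ d d' r).
  - by rewrite (comp_uniq Dj0 Dj2).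
  - by rewrite (comp_uniq Dj0 Dj1).
have [g gP] := choice exg.
have g_surj : set_surj setT setT g.
  move=> j _; have [y Djy] := Dn0 j.
  have [x /dom_comp[i Dix] fxy] := fsurj _ (comp_dom Djy).
  exists i => //; apply: comp_uniq Djy; rewrite -fxy; exact: gP.
have g_inj : injective g.
  apply: contrapT => g_ninj; apply: revD; exists g; split=> // j.
  rewrite card_eq_sym; apply/card_eq_set_bijP => //.
  exists (fun u => f u.2); split.
  - by move=> [i x] [/= <- Dix]; exact: gP.
  - move=> [i x] [i' x']; rewrite !inE => -[/= _ Dix] [/= _ Dix'] /=.
    move=> /(finj' _ _ (comp_dom Dix) (comp_dom Dix')) xx'.
    by rewrite -xx' in Dix' *; rewrite (comp_uniq Dix Dix').
  - move=> y Djy; have [x /dom_comp[i Dix] fxy] := fsurj _ (comp_dom Djy).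
    exists (i, x) => //; split=> //=.
    by apply: comp_uniq Djy; rewrite -fxy; exact: gP.
split=> // x y dx dy; split; first exact: fhom.2.
move=> r; have [j [Djx Djy]] := rel_comp _ _ r.
have [i Dix] := dom_comp dx; have [i' Diy] := dom_comp dy.
have ii' : i = i'.
  apply: g_inj; rewrite -(comp_uniq Djx (gP _ _ Dix)).
  exact: comp_uniq Djy (gP _ _ Diy).
by rewrite -ii' in Diy; exact: (hom_reflects f i).
Qed.

Lemma seq_of_reversible : reversible X -> reversible_seq D.
Proof.
move=> revX [g [g_surj g_ninj gsum]].
have [phi phiP] := choice (fun j => gluing _ _ (gsum j)).
have phi_bij j := (phiP j).1.
(* By disjointness the value does not depend on [i]; points outside all components are fixed by
   default. *)
have exf x : exists y, forall i, D i x -> y = phi (g i) (i, x).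
  have [[i Dix]|nD] := pselect (exists i, D i x).
    by exists (phi (g i) (i, x)) => i' Di'x; rewrite (comp_uniq Dix Di'x).
  by exists x => i Dix; case: nD; exists i.
have [f fP] := choice exf.
have f_comp i x : D i x -> D (g i) (f x).
  move=> Dix; rewrite (fP _ _ Dix).
  by have [pf _ _] := phi_bij (g i); apply: pf.
have fbij : set_bij (dom X) (dom X) f.
  split.
  - by move=> x /dom_comp[i Dix]; exact: comp_dom (f_comp _ _ Dix).
  - move=> x y; rewrite !inE => /dom_comp[i Dix] /dom_comp[j Djy] fxy.
    have gij : g i = g j.
      by apply: comp_uniq (f_comp _ _ Dix) _; rewrite fxy; exact: f_comp.
    have [_ pinj _] := phi_bij (g j).
    move: fxy; rewrite (fP _ _ Dix) (fP _ _ Djy) gij => /pinj.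
    by rewrite !inE => /(_ (conj gij Dix) (conj erefl Djy)) [].
  - move=> y /dom_comp[j Djy]; have [_ _ psurj] := phi_bij j.
    have [[i x] [/= gij Dix] pxy] := psurj _ Djy.
    by exists x; [exact: comp_dom Dix|rewrite (fP _ _ Dix) gij].
have fhom : homomorphism X X f.
  split; first by have [] := fbij.
  move=> x y _ _ r; have [i [Dix Diy]] := rel_comp _ _ r.
  by rewrite (fP _ _ Dix) (fP _ _ Diy); exact: (phiP (g i)).2.
have [_ faut] := revX f fbij fhom.
(* If [g i = g i'], the images of base points of [D i] and [D i'] lie in one component, hence are
   equal or related; pulling this back along the automorphism [f] forces [i = i']. *)
apply: g_ninj => i i' gii'.
have [x Dix] := Dn0 i; have [x' Dix'] := Dn0 i'.
have [dx dx'] := (comp_dom Dix, comp_dom Dix').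
have same_comp y y' : rel_of X (y, y') -> D i y -> D i' y' -> i = i'.
  move=> /rel_comp[j [Djy Djy']] Diy Diy'.
  by rewrite (comp_uniq Diy Djy) (comp_uniq Diy' Djy').
have [fxx'|fxx'] := pselect (f x = f x').
  have [_ finj _] := fbij.
  have xx' : x = x' by apply: finj; rewrite ?inE.
  by rewrite -xx' in Dix'; exact: comp_uniq Dix Dix'.
have Dfx' : D (g i) (f x') by rewrite gii'; exact: f_comp.
case: (comp_rel _ _ _ (f_comp _ _ Dix) Dfx' fxx') => r.
  exact: same_comp _ _ ((faut _ _ dx dx').2 r) Dix Dix'.
have [j [Djx' Djx]] := rel_comp _ _ ((faut _ _ dx' dx).2 r).
by rewrite (comp_uniq Dix Djx) (comp_uniq Dix' Djx').
Qed.

Lemma reversible_iff_seq : reversible X <-> reversible_seq D.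
Proof. by split; [exact: seq_of_reversible|exact: reversible_of_seq]. Qed.

End Components.

(** * The three classes of structures *)

Lemma card_sum_set_bij {T I} {D : I -> set T} {J : set I} {j} :
  D j !=set0 -> (D j #= card_sum_repr J D)%card ->
  exists phi : I * T -> T, set_bij (J `*`` D) (D j) phi.
Proof. by move=> Dj0; rewrite card_eq_sym => /(card_eq_set_bijP Dj0). Qed.

(** The relation is full on each class, so reflection and gluing only ask that points stay in the
    right class. *)
Lemma reversible_equivalence T I (X : relstruct T) (F : I -> set T) :
  equivalence_struct X -> indexes_classes X F ->
  (reversible X <-> reversible_seq F).
Proof.
move=> [Xrefl Xsym Xtrans] [Finj Frange].
have Fclass i : exists2 x, dom X x & Defs.equiv_class X x = F i.
  by have : range F (F i) by [exists i]; rewrite Frange.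
have classF x : dom X x -> exists i, F i = Defs.equiv_class X x.
  move=> dx; have : range F (Defs.equiv_class X x) by rewrite Frange; exists x.
  by move=> [i _ Fi]; exists i.
have F_rel i x y : F i x -> F i y -> rel_of X (x, y).
  by have [z _ <-] := Fclass i => /= /Xsym zx zy; exact: Xtrans zx zy.
have F_rel_in i x y : F i x -> rel_of X (x, y) -> F i y.
  by have [z _ <-] := Fclass i => /=; exact: Xtrans.
have rel_F x y : rel_of X (x, y) -> exists i, F i x /\ F i y.
  move=> xy; have [dx _] := rel_of_sub xy.
  have [i Fi] := classF x dx; exists i; rewrite Fi.
  by split=> //; exact: Xrefl.
have F0 i : F i !=set0.
  by have [x dx <-] := Fclass i; exists x; exact: Xrefl.
apply: reversible_iff_seq => //.
- apply/seteqP; split=> [x /Xrefl/rel_F[i [Fix _]]|x [i _ Fix]].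
    by exists i.
  by have [] := rel_of_sub (F_rel _ _ _ Fix Fix).
- move=> i j _ _ [x [Fix Fjx]]; apply: Finj.
  apply/seteqP; split=> y Fy.
    exact: F_rel_in Fjx (F_rel _ _ _ Fix Fy).
  exact: F_rel_in Fix (F_rel _ _ _ Fjx Fy).
- by move=> i x y Fix Fiy _; left; exact: F_rel Fiy.
- by move=> f i x y _ _ Fix Fiy _; exact: F_rel Fiy.
- move=> J j /(card_sum_set_bij (F0 j))[phi phi_bij].
  exists phi; split=> // i x y Ji Fix Fiy _.
  by have [pf _ _] := phi_bij; apply: (F_rel j); apply: pf.
Qed.

Lemma union_rel_in {T I} {X : I -> relstruct T} {i x} y :
  pairwise_disjoint X -> dom (X i) x ->
  rel_of (union_struct X) (x, y) <-> rel_of (X i) (x, y).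
Proof.
move=> Xdisj dx; split=> [[j _ r]|r]; last by exists i.
have [djx _] := rel_of_sub r.
by rewrite (Xdisj i j) //; exists x.
Qed.

Lemma union_rel_comp {T I} {X : I -> relstruct T} {x y} :
  rel_of (union_struct X) (x, y) -> exists i, dom (X i) x /\ dom (X i) y.
Proof. by move=> [i _ /rel_of_sub[dx dy]]; exists i. Qed.

(** Inside a component adjacency is distinctness, which every injection preserves and every map
    reflects. *)
Lemma reversible_complete_graphs T I (X : I -> relstruct T) :
  pairwise_disjoint X -> (forall i, dom (X i) !=set0) ->
  (forall i, complete_graph (X i)) ->
  (reversible (union_struct X) <-> reversible_seq (fun i => dom (X i))).
Proof.
move=> Xdisj X0 Xcompl.
have relE i x y : dom (X i) x -> dom (X i) y ->
    rel_of (union_struct X) (x, y) <-> x <> y.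
  move=> dx dy; apply: iff_trans (Xcompl i x y dx dy).
  exact: union_rel_in.
apply: reversible_iff_seq => //.
- by move=> x y /union_rel_comp.
- by move=> i x y dx dy xy; left; apply/(relE i).
- move=> f i x y _ _ dx dy r; apply/(relE i) => // xy.
  have [j [djx djy]] := union_rel_comp r.
  by move: r => /(relE j _ _ djx djy); rewrite xy.
- move=> J j /(card_sum_set_bij (D := fun i => dom (X i)) (X0 j))[phi phi_bij].
  have [pf pinj _] := phi_bij.
  exists phi; split=> // i x y Ji dx dy /(relE i _ _ dx dy) xy.
  apply/(relE j); [exact: pf|exact: pf|].
  by move=> /pinj; rewrite !inE => /(_ (conj Ji dx) (conj Ji dy)) [].
Qed.

Lemma reversible_ordinals T I (X : I -> relstruct T) :
  pairwise_disjoint X -> (forall i, iso_nonzero_ordinal_le_omega (X i)) ->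
  (reversible (union_struct X) <-> reversible_seq (fun i => dom (X i))).
Proof.
move=> Xdisj /choice[o oP].
have /choice[r rP] := fun i => (oP i).2.
have rbij i : set_bij (dom (X i)) (ordinal_dom (o i)) (r i) := (rP i).1.
have rfun i x : dom (X i) x -> ordinal_dom (o i) (r i x).
  by have [rf _ _] := rbij i; exact: rf.
have rinj i x y : dom (X i) x -> dom (X i) y -> r i x = r i y -> x = y.
  by move=> dx dy; have [_ + _] := rbij i; apply; rewrite inE.
have rsurj i n : ordinal_dom (o i) n -> exists2 x, dom (X i) x & r i x = n.
  by have [_ _ rs] := rbij i; exact: rs.
have relE i x y : dom (X i) x -> dom (X i) y ->
    rel_of (union_struct X) (x, y) <-> r i x <= r i y.
  move=> dx dy; apply: iff_trans (union_rel_in _ Xdisj dx) _.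
  apply: iff_trans ((rP i).2 x y dx dy) _.
  by split=> [[]//|le]; split=> //; split; exact: rfun.
have X0 i : dom (X i) !=set0.
  have : ordinal_dom (o i) 0 by case: (o i) (oP i).1 => [[|n]|].
  by move=> /rsurj[x dx _]; exists x.
apply: reversible_iff_seq => //.
- by move=> x y /union_rel_comp.
- move=> i x y dx dy _; rewrite !(relE i)//.
  by apply/orP; exact: leq_total.
(* If [y] were strictly below [x], then [f x] and [f y] would lie below each other, hence coincide,
   against injectivity. *)
- move=> f i x y [_ finj _] [_ fhom] dx dy fxy; apply/(relE i) => //.
  rewrite leqNgt; apply/negP => yx; have yx' := ltnW yx.
  have [ux uy] : dom (union_struct X) x /\ dom (union_struct X) y.
    by split; exists i.
  have fyx : rel_of (union_struct X) (f y, f x).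
    by apply: fhom => //; apply/(relE i).
  have [j [djx djy]] := union_rel_comp fxy.
  have exy : x = y.
    apply: finj; rewrite ?inE//; apply: (rinj j) => //.
    by apply/eqP; rewrite eqn_leq; apply/andP; split; apply/(relE j).
  by rewrite exy ltnn in yx.
- move=> J j DjJ; set E := J `*`` (fun i => dom (X i)).
  have [psi [psifun psiinj _]] :=
    card_sum_set_bij (D := fun i => dom (X i)) (X0 j) DjJ.
  have [x0 x0P] := choice X0.
  (* The bijection [psi] need not be monotone; it only serves to code the indices in [J] by natural
     numbers, through one base point per chain. *)
  pose c i := r j (psi (i, x0 i)).
  have c_inj i i' : J i -> J i' -> c i = c i' -> i = i'.
    move=> Ji Ji' /rinj cc.
    suff /psiinj : psi (i, x0 i) = psi (i', x0 i').
      by rewrite !inE => /(_ (conj Ji (x0P i)) (conj Ji' (x0P i'))) [].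
    by apply: cc; apply: psifun; split=> //=; exact: x0P.
  pose h (u : I * T) := 2 ^ c u.1 * (r u.1 u.2).*2.+1.
  have hinj : set_inj E h.
    move=> [i x] [i' x']; rewrite !inE => -[/= Ji dx] [/= Ji' dx'].
    move=> /odd_pow2_inj[/= /(c_inj _ _ Ji Ji') ii'].
    by rewrite -ii' in dx' * => /(rinj _ _ _ dx dx') ->.
  have Eo : (E #= ordinal_dom (o j))%card.
    rewrite card_eq_sym; apply: card_eq_trans DjJ.
    rewrite card_eq_sym; apply/card_eq_set_bijP; last by exists (r j).
    by exists (r j (x0 j)); exact: rfun.
  have [k [[kfun kinj ksurj] kle]] := collapse_to_ordinal hinj Eo.
  (* [s] inverts the chart [r j] on its ordinal; elsewhere [x0 j] is a dummy value. *)
  have exs n : exists y, ordinal_dom (o j) n -> dom (X j) y /\ r j y = n.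
    have [/rsurj[y dy ry]|no] := pselect (ordinal_dom (o j) n).
      by exists y.
    by exists (x0 j).
  have [s sP] := choice exs.
  have ks u : E u -> dom (X j) (s (k u)) /\ r j (s (k u)) = k u.
    by move=> Eu; apply: sP; exact: kfun.
  exists (fun u => s (k u)); split; first split.
  + by move=> u /ks[].
  + move=> u v Eu Ev suv; apply: kinj => //; move: Eu Ev; rewrite !inE.
    by move=> /ks[_ <-] /ks[_ <-]; rewrite suv.
  + move=> y dy; have [u Eu kuy] := ksurj _ (rfun _ _ dy).
    have [ds rs] := ks u Eu; exists u => //; apply: (rinj j) => //.
    by rewrite rs.
  + move=> i x y Ji dx dy /(relE i _ _ dx dy) xy.
    have [Ex Ey] : E (i, x) /\ E (i, y) by [].
    have [[dsx rsx] [dsy rsy]] := (ks _ Ex, ks _ Ey).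
    apply/(relE j) => //; rewrite rsx rsy; apply: kle => //.
    (* Both points carry the same index [i], so the powers of 2 cancel and only the positions in the
       chain are compared. *)
    by rewrite leq_pmul2l ?expn_gt0// ltnS leq_double.
Qed.

Theorem theorem3p2 (T I : Type) :
  (forall (X : relstruct T) (F : I -> set T),
      dom X !=set0 -> equivalence_struct X -> indexes_classes X F ->
      (reversible X <-> reversible_seq F)) /\
  (forall X : I -> relstruct T,
      pairwise_disjoint X ->
      (forall i, dom (X i) !=set0) -> (forall i, complete_graph (X i)) ->
      (reversible (union_struct X) <-> reversible_seq (fun i => dom (X i)))) /\
  (forall X : I -> relstruct T,
      pairwise_disjoint X ->
      (forall i, iso_nonzero_ordinal_le_omega (X i)) ->
      (reversible (union_struct X) <-> reversible_seq (fun i => dom (X i)))).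
Proof.
split; first by move=> X F _; exact: reversible_equivalence.
by split=> X; [exact: reversible_complete_graphs|exact: reversible_ordinals].
Qed.
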